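(* Let X be E or S. If the programming language is end-of-file data segment and has a blank character, then $$\forall T \in \textnormal{three-way(X)}: \exists c_T > 0: \exists n_T \in \mathbb{N}: \forall n \geq n_T: \frac{\overline h_T(n)}{p(n)} \geq c_T \wedge \frac{\overline d_T(n)}{p(n)} \geq c_T .$$
   Context: Programs are strings over a finite alphabet $\Sigma$ ($|\Sigma|\ge2$) in a Turing-complete programming language in which programs can construct, test and simulate other programs; each program on each input halts or runs forever; $p(n)$ is the number of programs of size (length) $n$. The language is end-of-file data segment if each program is the concatenation of an actual program, written in a self-delimiting language (the set of actual programs is decidable and none is a proper prefix of another), and a data segment, an arbitrary string over $\Sigma$ extending to the end of the file; the language has a construct via which the actual program can read the contents of the data segment. A blank character is a character that, for any program, can be inserted at at least one place in the program without affecting the meaning of the program. Variants: E — instances are programs, question: does the program halt on the empty input; S — instances are programs, question: does the program halt when given itself as input. A three-way tester for X is a program that on every instance halts with ``yes'', ``no'' or ``I don't know'', where ``yes'' is only given on halting and ``no'' only on non-halting instances; three-way(X) is the set of these. An instance is hard for $T$ if $T$ answers ``I don't know'' on it. $\overline h_T(n)$ and $\overline d_T(n)$ are the numbers of hard halting and hard non-halting instances of size $n$. *)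

(* Defs.v *)
From HB Require Import structures.
From mathcomp Require Import all_boot all_order all_algebra.
From mathcomp Require Import boolp reals.

Set Implicit Arguments.
Unset Strict Implicit.
Unset Printing Implicit Defensive.

Import Order.TTheory GRing.Theory Num.Theory.
Local Open Scope ring_scope.

(* Kleene's partial recursive functions, on words over [Sigma] rather than on
   numbers: zero is the empty word, there is one successor per letter, primitive
   recursion is on the first letter, and minimisation searches through the
   powers of a letter.  This is the reference notion of partial computability. *)
Inductive wordfun (Sigma : Type) : nat -> Type :=
| Wnil n : wordfun Sigma n
| Wcons (a : Sigma) : wordfun Sigma 1
| Wproj n (i : 'I_n) : wordfun Sigma n
| Wcomp m n (f : wordfun Sigma m) (g : 'I_m -> wordfun Sigma n) :
    wordfun Sigma n
| Wrec n (g : wordfun Sigma n) (h : Sigma -> wordfun Sigma n.+2) :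
    wordfun Sigma n.+1
| Wmu n (a : Sigma) (f : wordfun Sigma n.+1) : wordfun Sigma n.

Arguments Wnil {Sigma} n.
Arguments Wproj {Sigma n} i.

Fixpoint rec_graph (Sigma : Type) n (G : n.-tuple (seq Sigma) -> seq Sigma -> Prop)
    (H : Sigma -> n.+2.-tuple (seq Sigma) -> seq Sigma -> Prop)
    (w : seq Sigma) (xs : n.-tuple (seq Sigma)) (y : seq Sigma) : Prop :=
  match w with
  | [::] => G xs y
  | a :: v => exists2 z, rec_graph G H v xs z & H a [tuple of v :: z :: xs] y
  end.

(* [weval f xs y]: [f] is defined at [xs], with value [y]. *)
Fixpoint weval (Sigma : Type) n (f : wordfun Sigma n) :
    n.-tuple (seq Sigma) -> seq Sigma -> Prop :=
  match f in wordfun _ n return n.-tuple (seq Sigma) -> seq Sigma -> Prop with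
  | Wnil _ => fun _ y => y = [::]
  | Wcons a => fun xs y => y = a :: thead xs
  | Wproj _ i => fun xs y => y = tnth xs i
  | Wcomp m _ f g => fun xs y =>
      exists2 zs : m.-tuple (seq Sigma),
        forall i, weval (g i) xs (tnth zs i) & weval f zs y
  | Wrec _ g h => fun xs y =>
      rec_graph (weval g) (fun a => weval (h a)) (thead xs) (behead_tuple xs) y
  | Wmu _ a f => fun xs y =>
      exists k, [/\ y = nseq k a, weval f [tuple of y :: xs] [::] &
        forall j, (j < k)%N ->
          exists2 z, z <> [::] & weval f [tuple of nseq j a :: xs] z]
  end.

Definition decidable_set (Sigma : eqType) (P : pred (seq Sigma)) : Prop :=
  exists f : wordfun Sigma 1,
    forall w, exists2 y, weval f [tuple w] y & P w = (y == [::]).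

(* [run p x y]: program [p] halts on input [x] with output [y]; only its values
   at programs [p] matter. *)
Record language (Sigma : finType) := Language {
  program : pred (seq Sigma);
  run : seq Sigma -> seq Sigma -> seq Sigma -> Prop;
  run_det : forall p x y z, program p -> run p x y -> run p x z -> y = z
}.

Section Language.
Variables (Sigma : finType) (L : language Sigma).
Implicit Types (p x d w : seq Sigma).

Definition halts p x : Prop := exists y, run L p x y.

Definition turing_complete : Prop :=
  forall f : wordfun Sigma 1, exists2 p, program L p &
    forall x y, run L p x y <-> weval f [tuple x] y.

(* A constructor computes, from a word [d], a program with [d] wired in; this is
   the s-m-n property. *)
Definition can_construct_programs : Prop :=
  forall f : wordfun Sigma 2, exists s : wordfun Sigma 1,
    forall d, exists p, [/\ weval s [tuple d] p, program L p &
      forall x y, run L p x y <-> weval f [tuple d; x] y].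

Definition can_test_programs : Prop := decidable_set (program L).

Definition can_simulate_programs : Prop :=
  exists u : wordfun Sigma 2, forall p x y, program L p ->
    (weval u [tuple p; x] y <-> run L p x y).

Record general_purpose : Prop := GeneralPurpose {
  gp_turing_complete : turing_complete;
  gp_construct : can_construct_programs;
  gp_test : can_test_programs;
  gp_simulate : can_simulate_programs
}.

Definition self_delimiting (actual : pred (seq Sigma)) : Prop :=
  decidable_set actual /\
  forall a b, actual a -> actual b -> prefix a b -> a = b.

(* The last clause is the construct for reading the data segment: an actual
   program can compute any partial recursive function of its data segment and
   its input. *)
Definition eof_data_segment : Prop :=
  exists actual : pred (seq Sigma),
    [/\ self_delimiting actual,
        forall p, program L p <-> exists a d, actual a /\ p = a ++ d
      & forall f : wordfun Sigma 2, exists2 a, actual a &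
          forall d x y, run L (a ++ d) x y <-> weval f [tuple d; x] y].

Definition has_blank : Prop :=
  exists b : Sigma, forall p, program L p ->
    exists p1 p2, [/\ p = p1 ++ p2, program L (p1 ++ b :: p2) &
      forall x y, run L (p1 ++ b :: p2) x y <-> run L p x y].

End Language.

Variant halting_variant := variantE | variantS.

Definition input_of (Sigma : Type) (X : halting_variant) (p : seq Sigma) :
    seq Sigma :=
  match X with variantE => [::] | variantS => p end.

Variant answer := Yes | No | DontKnow.

Section Tester.
Variables (Sigma : finType) (L : language Sigma).
(* The words by which testers express their answers. *)
Variable enc : answer -> seq Sigma.
Variable X : halting_variant.
Implicit Types (T p : seq Sigma).

Definition halting_instance p : Prop := halts L p (input_of X p).

Definition three_way T : Prop :=
  program L T /\
  forall p, program L p ->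
    [/\ exists ans, run L T p (enc ans),
        run L T p (enc Yes) -> halting_instance p
      & run L T p (enc No) -> ~ halting_instance p].

Definition hard T p : Prop := run L T p (enc DontKnow).

Definition num_programs (n : nat) : nat := #|[set p : n.-tuple Sigma | program L p]|.

Definition num_hard_halting T (n : nat) : nat :=
  #|[set p : n.-tuple Sigma |
      program L p && `[< hard T p /\ halting_instance p >]]|.

Definition num_hard_nonhalting T (n : nat) : nat :=
  #|[set p : n.-tuple Sigma |
      program L p && `[< hard T p /\ ~ halting_instance p >]]|.

End Tester.

(* Main.v *)
Require Import Defs.
From HB Require Import structures.
From mathcomp Require Import all_boot all_order all_algebra.
From mathcomp Require Import boolp reals.

Set Implicit Arguments.
Unset Strict Implicit.
Unset Printing Implicit Defensive.

Import Order.TTheory GRing.Theory Num.Theory.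
Local Open Scope ring_scope.

(** Programs can refer to themselves through their data segment: an actual
    program [a] whose data segment is [a ++ e] recovers [a] as the unique actual
    prefix of its data, hence knows its own text [a ++ a ++ e].  It can thus run
    the tester [T] on itself.  If it halts unless [T] says "yes", then [T] can
    only answer "I don't know" and the program halts; if it halts only when [T]
    says "no", then [T] can only answer "I don't know" and the program does not
    halt.  This holds for every [e], so a fraction [#|Sigma| ^ - (2 * size a)]
    of all words of a given length are hard instances of the given kind. *)

(** * Recursive word functions: determinism, basic operations, equality tests, parsing *)

Section WordFunctions.
Variable Sigma : finType.
Implicit Types (w v x y z : seq Sigma).

Lemma rec_graph_functional n (G : n.-tuple (seq Sigma) -> seq Sigma -> Prop)
    (H : Sigma -> n.+2.-tuple (seq Sigma) -> seq Sigma -> Prop) w xs y z :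
  (forall xs y z, G xs y -> G xs z -> y = z) ->
  (forall a xs y z, H a xs y -> H a xs z -> y = z) ->
  rec_graph G H w xs y -> rec_graph G H w xs z -> y = z.
Proof.
move=> Gfun Hfun; elim: w y z => [|a w IHw] y z /=; first exact: Gfun.
by case=> y' wy' Hy [z' wz' Hz]; rewrite (IHw _ _ wy' wz') in Hy; exact: Hfun Hy Hz.
Qed.

Lemma weval_functional n (f : wordfun Sigma n) xs y z :
  weval f xs y -> weval f xs z -> y = z.
Proof.
elim: f xs y z => {n} [n|a|n i|m n f IHf g IHg|n g IHg h IHh|n a f IHf] xs y z /=.
- by move=> -> ->.
- by move=> -> ->.
- by move=> -> ->.
- case=> ys gy fy [zs gz fz]; suff eq_yz : ys = zs by subst zs; exact: IHf fy fz.
  by apply: eq_from_tnth => i; exact: IHg (gy i) (gz i).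
- exact: rec_graph_functional.
- case=> k [-> fk ltk] [l [-> fl ltl]].
  (* If the searches stopped at different lengths, the longer one would have seen a nonempty value
     where the shorter one stopped on [[::]]. *)
  case: (ltngtP k l) => [lt_kl|lt_lk|-> //].
  + by case: (ltl k lt_kl) => t t_neq /(IHf _ _ _ fk) t0; case: t_neq.
  + by case: (ltk l lt_lk) => t t_neq /(IHf _ _ _ fl) t0; case: t_neq.
Qed.

(** Since values are unique, the intermediate results must be [zs]. The equivalence carries
    undefinedness of [f] as well as its values, which the non-halting case requires. *)
Lemma weval_comp m n (f : wordfun Sigma m) (g : 'I_m -> wordfun Sigma n) xs zs y :
  (forall i, weval (g i) xs (tnth zs i)) ->
  weval (Wcomp f g) xs y <-> weval f zs y.
Proof.
move=> gz; split=> [[ts gt ft]|fz]; last by exists zs.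
suff -> : zs = ts by [].
by apply: eq_from_tnth => i; exact: weval_functional (gz i) (gt i).
Qed.

Definition Wcomp1 n (f : wordfun Sigma 1) (g : wordfun Sigma n) :=
  Wcomp f (fun=> g).

Definition Wcomp2 n (f : wordfun Sigma 2) (g h : wordfun Sigma n) :=
  Wcomp f (fun i => if i == ord0 then g else h).

Lemma weval_comp1 n (f : wordfun Sigma 1) (g : wordfun Sigma n) xs z y :
  weval g xs z -> weval (Wcomp1 f g) xs y <-> weval f [tuple z] y.
Proof. by move=> gz; apply: weval_comp => i; rewrite ord1. Qed.

Lemma weval_comp2 n (f : wordfun Sigma 2) (g h : wordfun Sigma n) xs z t y :
  weval g xs z -> weval h xs t ->
  weval (Wcomp2 f g h) xs y <-> weval f [tuple z; t] y.
Proof.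
by move=> gz ht; apply: weval_comp => -[[|[|//]] lt_i].
Qed.

Lemma weval_rec n (g : wordfun Sigma n) (h : Sigma -> wordfun Sigma n.+2) xs
    (F : seq Sigma -> seq Sigma) w :
  weval g xs (F [::]) ->
  (forall a v, weval (h a) [tuple of v :: F v :: xs] (F (a :: v))) ->
  weval (Wrec g h) [tuple of w :: xs] (F w).
Proof.
move=> gF hF /=; rewrite theadE.
have -> : behead_tuple [tuple of w :: xs] = xs by exact: val_inj.
by elim: w => [|a w IHw] //=; exists (F w).
Qed.

Lemma weval_proj n (i : 'I_n) (xs : n.-tuple (seq Sigma)) y :
  tnth xs i = y -> weval (Wproj i) xs y.
Proof. by move=> <-. Qed.

Definition Wproj0 n : wordfun Sigma n.+1 := Wproj (Ordinal (isT : 0 < n.+1)%N).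
Definition Wproj1 n : wordfun Sigma n.+2 := Wproj (Ordinal (isT : 1 < n.+2)%N).
Definition Wproj2 n : wordfun Sigma n.+3 := Wproj (Ordinal (isT : 2 < n.+3)%N).

Fixpoint Wconst n w : wordfun Sigma n :=
  if w is a :: v then Wcomp1 (Wcons a) (Wconst n v) else Wnil n.

Lemma weval_const n w (xs : n.-tuple (seq Sigma)) : weval (Wconst n w) xs w.
Proof. by elim: w => // a w IHw; apply/(weval_comp1 _ _ IHw). Qed.

Definition Wcat : wordfun Sigma 2 :=
  Wrec (Wproj0 0) (fun a => Wcomp1 (Wcons a) (Wproj1 1)).

Lemma weval_cat w v : weval Wcat [tuple w; v] (w ++ v).
Proof.
apply: (weval_rec (xs := [tuple v]) (F := cat^~ v)) => // a u.
by apply/(weval_comp1 _ (z := u ++ v)) => //; exact: weval_proj.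
Qed.

Definition Wbehead : wordfun Sigma 1 := Wrec (Wnil 0) (fun=> Wproj0 1).

Lemma weval_behead w : weval Wbehead [tuple w] (behead w).
Proof. exact: (weval_rec (xs := [tuple]) (F := behead)). Qed.

Definition Whead : wordfun Sigma 1 := Wrec (Wnil 0) (fun a => Wconst 2 [:: a]).

Lemma weval_head w : weval Whead [tuple w] (take 1 w).
Proof.
apply: (weval_rec (xs := [tuple]) (F := take 1)) => // a v.
by rewrite (_ : take 1 (a :: v) = [:: a]) ?[LHS]/= ?take0 //; exact: weval_const.
Qed.

(** The first argument is a unary numeral: its length counts and its letters are ignored. *)
Definition Wdrop : wordfun Sigma 2 :=
  Wrec (Wproj0 0) (fun=> Wcomp1 Wbehead (Wproj1 1)).

Lemma weval_drop w v : weval Wdrop [tuple w; v] (drop (size w) v).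
Proof.
apply: (weval_rec (xs := [tuple v]) (F := fun u => drop (size u) v)) => [|a u].
  by rewrite drop0.
apply/(weval_comp1 _ (z := drop (size u) v)); first exact: weval_proj.
by have := weval_behead (drop (size u) v); rewrite -drop1 drop_drop.
Qed.

(** Each step appends the next letter of the second argument, obtained as the head of what [Wdrop]
    leaves. *)
Definition Wtake : wordfun Sigma 2 :=
  Wrec (Wnil 1) (fun=>
    Wcomp2 Wcat (Wproj1 1) (Wcomp1 Whead (Wcomp2 Wdrop (Wproj0 2) (Wproj2 0)))).

Lemma weval_take w v : weval Wtake [tuple w; v] (take (size w) v).
Proof.
apply: (weval_rec (xs := [tuple v]) (F := fun u => take (size u) v)) => [|a u].
  by rewrite take0.
apply/(weval_comp2 _ (z := take (size u) v) (t := take 1 (drop (size u) v))).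
- exact: weval_proj.
- apply/(weval_comp1 _ (z := drop (size u) v)); last exact: weval_head.
  by apply/(weval_comp2 _ (z := u) (t := v)); [exact: weval_proj.. | exact: weval_drop].
- by have := weval_cat (take (size u) v) (take 1 (drop (size u) v));
  rewrite -takeD addn1.
Qed.

(** Induction on [w], with recursion on [v] used only as case analysis on its first letter: a match
    passes the tail to the test for the rest of [w], and a mismatch gives the constant value for
    unequal words. *)
Lemma eq_test_exists (s : Sigma) (b : bool) w :
  exists f : wordfun Sigma 1, forall v,
    weval f [tuple v] (if (v == w) == b then [::] else [:: s]).
Proof.
pose F u v := if (v == u) == b then [::] else [:: s].
elim: w => [|a w [f fP]].
  exists (Wrec (Wconst 0 (F [::] [::])) (fun a => Wconst 2 (F [::] [:: a]))) => v.
  apply: (weval_rec (xs := [tuple]) (F := F [::])) => [|a u]; exact: weval_const.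
exists (Wrec (Wconst 0 (F (a :: w) [::]))
  (fun c => if c == a then Wcomp1 f (Wproj0 1) else Wconst 2 (F [::] [:: c]))) => v.
apply: (weval_rec (xs := [tuple]) (F := F (a :: w))) => [|c u].
  exact: weval_const.
have [->|neq_ca] := eqVneq c a.
  rewrite /F eqseq_cons eqxx andTb.
  by apply/(weval_comp1 _ (z := u)); [exact: weval_proj | exact: fP].
have -> : F (a :: w) (c :: u) = F [::] [:: c].
  by rewrite /F eqseq_cons (negbTE neq_ca).
exact: weval_const.
Qed.

(* The minimisation ignores its search variable: it succeeds at once or never. *)
Lemma semidecide_exists (s : Sigma) (b : bool) w :
  exists f : wordfun Sigma 1, forall v,
    (exists y, weval f [tuple v] y) <-> (v == w) = b.
Proof.
have [f fP] := eq_test_exists s b w.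
exists (Wmu s (Wcomp1 f (Wproj1 0))) => v.
have compE k y : weval (Wcomp1 f (Wproj1 0)) [tuple of nseq k s :: [tuple v]] y <->
    weval f [tuple v] y by apply: weval_comp1; exact: weval_proj.
split=> [[_ [k [-> /(compE k) fk _]]]|vwb].
  have := weval_functional (fP v) fk.
  by case: eqP.
exists [::]; exists 0%N; split=> //.
by apply/(compE 0%N); have := fP v; rewrite vwb eqxx.
Qed.

(* On [actual a], self-delimitation makes [a] the only prefix of [a ++ e] that the
   search can stop at. *)
Lemma self_delimiting_parser (s : Sigma) (actual : pred (seq Sigma)) :
  self_delimiting actual ->
  exists f : wordfun Sigma 1, forall a e, actual a -> weval f [tuple a ++ e] a.
Proof.
case=> -[dec decP] prefix_free.
(* Minimisation returns a power of [s], whose length tells [Wtake] how much of the input to keep. *)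
exists (Wcomp2 Wtake
  (Wmu s (Wcomp1 dec (Wcomp2 Wtake (Wproj0 1) (Wproj1 0)))) (Wproj0 0)).
move=> a e act_a.
have testE k y : weval (Wcomp1 dec (Wcomp2 Wtake (Wproj0 1) (Wproj1 0)))
    [tuple of nseq k s :: [tuple a ++ e]] y <-> weval dec [tuple take k (a ++ e)] y.
  apply: weval_comp1.
  apply/(weval_comp2 _ (z := nseq k s) (t := a ++ e)); [exact: weval_proj..|].
  by have := weval_take (nseq k s) (a ++ e); rewrite size_nseq.
apply/(weval_comp2 _ (z := nseq (size a) s) (t := a ++ e)).
- exists (size a); split=> // [|k lt_ka].
    apply/testE; rewrite take_size_cat //.
    by have [y dec_y] := decP a; rewrite act_a => /esym/eqP y0; rewrite -y0.
  have [y dec_y act_y] := decP (take k (a ++ e)).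
  exists y; last exact/testE.
  move=> y0; move: act_y; rewrite y0 eqxx takel_cat ?(ltnW lt_ka) // => act_k.
  have /(congr1 size) := prefix_free _ _ act_k act_a (prefix_take a k).
  by rewrite size_takel ?(ltnW lt_ka) // => eq_ka; rewrite eq_ka ltnn in lt_ka.
- exact: weval_proj.
- by have := weval_take (nseq (size a) s) (a ++ e); rewrite size_nseq take_size_cat.
Qed.

(** Appending words of length [n - size w] to [w] is injective and lands in [P]. *)
Lemma card_prefix_le (P : pred (seq Sigma)) w n :
  (size w <= n)%N -> (forall e, P (w ++ e)) ->
  (#|Sigma| ^ (n - size w) <= #|[set t : n.-tuple Sigma | P t]|)%N.
Proof.
move=> /subnKC; set k := (n - size w)%N => <- Pw.
pose ext (t : k.-tuple Sigma) := cat_tuple (in_tuple w) t.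
have ext_inj : injective ext.
  move=> t u /(congr1 val) /= /eqP; rewrite eqseq_cat // => /andP[_ /eqP tu].
  exact: val_inj.
rewrite -card_tuple -cardsT -(card_imset _ ext_inj); apply: subset_leq_card.
by apply/subsetP => _ /imsetP[t _ ->]; rewrite inE; exact: Pw.
Qed.

End WordFunctions.

(** * Programs that run the tester on themselves *)

Section SelfTesting.
Variables (Sigma : finType) (L : language Sigma).

(** The parameters [c] and [b] cover both constructions: halt unless the answer is [c], or only if
    it is. The input [x] is ignored, so both halting variants are treated at once. *)
Lemma self_testing_program (s : Sigma) (T c : seq Sigma) (b : bool) :
  can_simulate_programs L -> eof_data_segment L -> program L T ->
  exists w, forall e, program L (w ++ e) /\
    forall r, run L T (w ++ e) r ->
      forall x, halts L (w ++ e) x <-> (r == c) = b.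
Proof.
move=> [u uP] [actual [delim progE readP]] prog_T.
have [parse parseP] := self_delimiting_parser s delim.
have [halt_if haltP] := semidecide_exists s b c.
(* From the data segment [a ++ e], [self] rebuilds the whole program text [a ++ a ++ e]. It does not
   mention [a], so [a] can be chosen afterwards without circularity. *)
pose self := Wcomp2 (Wcat Sigma) (Wcomp1 parse (Wproj0 Sigma 1)) (Wproj0 Sigma 1).
have [a act_a aP] := readP (Wcomp1 halt_if (Wcomp2 u (Wconst 2 T) self)).
exists (a ++ a) => e; rewrite -catA; split=> [|r run_r x].
  by apply/progE; exists a, (a ++ e).
have selfP : weval self [tuple a ++ e; x] (a ++ a ++ e).
  apply/(weval_comp2 _ (z := a) (t := a ++ e)); last exact: weval_cat.
    apply/(weval_comp1 _ (z := a ++ e)); first exact: weval_proj.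
    exact: parseP.
  exact: weval_proj.
have testP : weval (Wcomp2 u (Wconst 2 T) self) [tuple a ++ e; x] r.
  apply/(weval_comp2 _ _ (weval_const _ _) selfP); exact/uP.
split=> [[y /aP/(weval_comp1 _ _ testP) y_r]|/haltP[y y_r]].
  by apply/haltP; exists y.
by exists y; apply/aP/(weval_comp1 _ _ testP).
Qed.

Variables (enc : answer -> seq Sigma) (X : halting_variant) (T : seq Sigma).
Hypotheses (enc_inj : injective enc) (T3 : three_way L enc X T).
Hypotheses (L_sim : can_simulate_programs L) (L_eof : eof_data_segment L).

Lemma hard_halting_prefix (s : Sigma) :
  exists w, forall e, program L (w ++ e) &&
    `[< hard L enc T (w ++ e) /\ halting_instance L X (w ++ e) >].
Proof.
case: T3 => prog_T TP.
have [w wP] := self_testing_program s (enc Yes) false L_sim L_eof prog_T.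
exists w => e; have [prog_p /= pP] := wP e; rewrite prog_p; apply/asboolP.
have [[ans run_ans] yes_halt no_loop] := TP _ prog_p.
have {}pP := pP _ run_ans (input_of X (w ++ e)).
(* [Yes] would make the program loop and [No] would make it halt, against soundness of [T]; on
   [DontKnow] it halts because [enc] separates the answers. *)
case: ans run_ans pP => run_ans pP.
- by have := yes_halt run_ans => /pP; rewrite eqxx.
- by case: (no_loop run_ans); apply/pP/eqP => /enc_inj.
- by split=> //; apply/pP/eqP => /enc_inj.
Qed.

Lemma hard_nonhalting_prefix (s : Sigma) :
  exists w, forall e, program L (w ++ e) &&
    `[< hard L enc T (w ++ e) /\ ~ halting_instance L X (w ++ e) >].
Proof.
case: T3 => prog_T TP.
have [w wP] := self_testing_program s (enc No) true L_sim L_eof prog_T.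
exists w => e; have [prog_p /= pP] := wP e; rewrite prog_p; apply/asboolP.
have [[ans run_ans] yes_halt no_loop] := TP _ prog_p.
have {}pP := pP _ run_ans (input_of X (w ++ e)).
case: ans run_ans pP => run_ans pP.
- by have := yes_halt run_ans => /pP/eqP/enc_inj.
- by case: (no_loop run_ans); apply/pP/eqP.
- by split=> // /pP/eqP/enc_inj.
Qed.

End SelfTesting.

(** * From hard prefixes to a positive proportion *)

(** At least [#|Sigma| ^ (n - size w)] words satisfy [P], and at most [#|Sigma| ^ n] satisfy [Q]. *)
Lemma prefix_proportion (R : realType) (Sigma : finType) (P Q : pred (seq Sigma))
    (w : seq Sigma) (N n : nat) :
  (0 < #|Sigma|)%N -> (size w <= N)%N -> (N <= n)%N ->
  (forall e, P (w ++ e)) -> (forall p, P p -> Q p) ->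
  (#|Sigma| ^ N)%:R^-1 <=
    #|[set t : n.-tuple Sigma | P t]|%:R / #|[set t : n.-tuple Sigma | Q t]|%:R :> R.
Proof.
move=> Sigma_gt0 le_wN le_Nn Pw PQ.
set h := #|_|; set q := #|_|.
have h_ge : (#|Sigma| ^ (n - size w) <= h)%N.
  by apply: card_prefix_le Pw; exact: leq_trans le_Nn.
have h_gt0 : (0 < h)%N by apply: leq_trans h_ge; rewrite expn_gt0 Sigma_gt0.
(* This makes [q] positive; otherwise the quotient would be [0] by the convention for division by
   zero. *)
have le_hq : (h <= q)%N.
  by apply: subset_leq_card; apply/subsetP => t; rewrite !inE; exact: PQ.
have le_q : (q <= #|Sigma| ^ N * h)%N.
  apply: (@leq_trans (#|Sigma| ^ n)); first by rewrite -card_tuple; exact: max_card.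
  apply: (@leq_trans (#|Sigma| ^ N * #|Sigma| ^ (n - size w))).
    by rewrite -expnD leq_pexp2l // -leq_subLR leq_sub2l.
  by rewrite leq_mul2l h_ge orbT.
rewrite ler_pdivlMr ?ltr0n ?(leq_trans h_gt0) // mulrC ler_pdivrMr; last first.
  by rewrite ltr0n expn_gt0 Sigma_gt0.
by rewrite -natrM ler_nat mulnC.
Qed.

Theorem theorem4 (R : realType) (Sigma : finType) (card_Sigma : (2 <= #|Sigma|)%N)
    (L : language Sigma) (L_gp : general_purpose L)
    (enc : answer -> seq Sigma) (enc_inj : injective enc)
    (X : halting_variant)
    (L_eof : eof_data_segment L) (L_blank : has_blank L) :
  forall T : seq Sigma, three_way L enc X T ->
  exists c : R, 0 < c /\
  exists nT : nat, forall n : nat, (nT <= n)%N ->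
    (num_hard_halting L enc X T n)%:R / (num_programs L n)%:R >= c /\
    (num_hard_nonhalting L enc X T n)%:R / (num_programs L n)%:R >= c.
Proof.
move=> T T3; have Sigma_gt0 : (0 < #|Sigma|)%N by exact: ltnW.
have /card_gt0P[s _] := Sigma_gt0.
have L_sim := gp_simulate L_gp.
have [v vP] := hard_halting_prefix enc_inj T3 L_sim L_eof s.
have [w wP] := hard_nonhalting_prefix enc_inj T3 L_sim L_eof s.
(* The sum bounds both prefix lengths, so one exponent serves both kinds of instances, and it is
   also the threshold [nT]. *)
exists (#|Sigma| ^ (size v + size w))%:R^-1.
split; first by rewrite invr_gt0 ltr0n expn_gt0 Sigma_gt0.
exists (size v + size w)%N => n le_n; split.
- pose P p := program L p && `[< hard L enc T p /\ halting_instance L X p >].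
  apply: (prefix_proportion (P := P) (Q := program L) _ _ _ le_n vP) => //.
    exact: leq_addr.
  by move=> p /andP[].
- pose P p := program L p && `[< hard L enc T p /\ ~ halting_instance L X p >].
  apply: (prefix_proportion (P := P) (Q := program L) _ _ _ le_n wP) => //.
    exact: leq_addl.
  by move=> p /andP[].
Qed.
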